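(* A semiflow $(T,X)$ on a compact Hausdorff space $X$ is uniformly distal if and only if it is equicontinuous and surjective.
   Context: $X$ is a nonempty compact Hausdorff space, $\mathscr U_X$ is its compatible uniformity (symmetric entourages), and $T$ is a discrete infinite semigroup with identity $e$. A semiflow $(T,X)$ is a continuous map $T\times X\to X$, $(t,x)\mapsto tx$, with $ex=x$ and $t(sx)=(ts)x$. $(T,X)$ is surjective if $tX=X$ for every $t\in T$. It is equicontinuous if for every $\varepsilon\in\mathscr U_X$ there is $\delta\in\mathscr U_X$ such that $(x,y)\in\delta$ implies $(tx,ty)\in\varepsilon$ for all $t\in T$. It is uniformly distal if for every $\varepsilon\in\mathscr U_X$ there is $\delta\in\mathscr U_X$ such that for all $x,y\in X$ with $(x,y)\notin\varepsilon$ one has $(tx,ty)\notin\delta$ for all $t\in T$. *)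

(* Defs.v *)
From HB Require Import structures.
From mathcomp Require Import all_boot.
From mathcomp Require Import boolp classical_sets topology.

Set Implicit Arguments.
Unset Strict Implicit.
Unset Printing Implicit Defensive.

Local Open Scope classical_set_scope.

(* A semigroup with identity is a [monoidType]; [discrete_topology T] is T with
   its discrete topology, so continuity is joint continuity on T x X. *)
Record semiflow (T : monoidType) (X : topologicalType) := Semiflow {
  semiflow_act :> T -> X -> X;
  semiflow_continuous :
    continuous (fun p : discrete_topology T * X => semiflow_act p.1 p.2);
  semiflow1 : forall x : X, semiflow_act 1%g x = x;
  semiflowM : forall (t s : T) (x : X),
    semiflow_act t (semiflow_act s x) = semiflow_act (t * s)%g x }.

Definition surjective_semiflow (T : monoidType) (X : topologicalType)
    (f : semiflow T X) : Prop :=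
  forall t : T, f t @` [set: X] = [set: X].

Definition sym_entourage (X : uniformType) (E : set (X * X)) : Prop :=
  entourage E /\ (E^-1)%relation = E.

(* One delta serves for all base points, unlike in the library's pointwise
   [equicontinuous]. *)
Definition equicontinuous_semiflow (T : monoidType) (X : uniformType)
    (f : semiflow T X) : Prop :=
  forall eps : set (X * X), sym_entourage eps ->
    exists2 delta : set (X * X), sym_entourage delta &
      forall x y : X, delta (x, y) -> forall t : T, eps (f t x, f t y).

Definition uniformly_distal (T : monoidType) (X : uniformType)
    (f : semiflow T X) : Prop :=
  forall eps : set (X * X), sym_entourage eps ->
    exists2 delta : set (X * X), sym_entourage delta &
      forall x y : X, ~ eps (x, y) -> forall t : T, ~ delta (f t x, f t y).

(* Main.v *)
Require Import Defs.
From HB Require Import structures.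
From mathcomp Require Import all_boot finmap.
From mathcomp Require Import boolp classical_sets cardinality topology.

Local Open Scope classical_set_scope.

(** The heart of the matter is that an equicontinuous semigroup of surjections
    of a compact space is uniformly distal. By equicontinuity and total
    boundedness, two powers s^i and s^(i+k), k > 0, of a member s are uniformly
    close; as s^i is onto, s^k is uniformly close to the identity. If s x and
    s y are close then so are s^k x and s^k y, hence so are x and y. This is
    one implication. For the other, a uniformly distal semiflow consists of
    injections; they are onto because in a totally bounded space t^i x returns
    close to t^j x for some j > i, whence x is close to t^(j-i) x. The inverses
    of the acting maps then satisfy the hypotheses of the first part, and their
    uniform distality is the equicontinuity of the semiflow. *)

(** Pigeonhole on the first [#|F|.+1] indices; writing the gap as [k.+1] keeps it positive. *)
Lemma nat_finType_collision (F : finType) (g : nat -> F) :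
  exists i k, g i = g (i + k.+1).
Proof.
apply: contrapT => nocoll.
suff inj : injective (fun i : 'I_#|F|.+1 => g i).
  by have := leq_card _ inj; rewrite card_ord ltnn.
have lt_neq i j : i < j -> g i <> g j.
  by move=> ij gij; apply: nocoll; exists i, (j - i.+1); rewrite addnS -addSn subnKC.
move=> i j gij; apply/val_inj/eqP; rewrite eqn_leq.
by apply/andP; split; rewrite leqNgt; apply/negP => /lt_neq; apply.
Qed.

Lemma sym_entourage_core (X : uniformType) (A : set (X * X)) :
  entourage A -> exists2 B, sym_entourage B & B `<=` A.
Proof.
move=> entA; exists (A `&` A^-1)%relation; last by move=> ? [].
split; first exact: entourage_invI.
by apply/seteqP; split=> -[x y] [].
Qed.

Lemma sym_entourage_split4 (X : uniformType) (A : set (X * X)) : entourage A ->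
  exists2 B, sym_entourage B &
    forall x y z u v, B (x, y) -> B (y, z) -> B (z, u) -> B (u, v) -> A (x, v).
Proof.
move=> entA; have entA2 := entourage_split_ent entA.
have [B symB BA] := sym_entourage_core _ _ (entourage_split_ent entA2).
exists B => // x y z u v /BA xy /BA yz /BA zu /BA uv.
apply: (entourage_split z) => //; first exact: (entourage_split y).
exact: (entourage_split u).
Qed.

Lemma sym_entourageC {X : uniformType} {E : set (X * X)} {x y : X} :
  sym_entourage E -> E (x, y) -> E (y, x).
Proof. by move=> [_ EC] Exy; rewrite -EC. Qed.

Lemma compact_finite_net (X : uniformType) (E : set (X * X)) :
  [set: X] !=set0 -> compact [set: X] -> entourage E ->
  exists (I : finType) (z : I -> X) (c : X -> I), forall x, E (z (c x), x).
Proof.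
move=> [x0 _] cX entE.
(* [compact_cover] is stated for pointed spaces only. *)
pose Y : ptopologicalType := HB.pack (X : Type) (isPointed.Build X x0) X.
have : @cover_compact Y [set: Y] by rewrite -compact_cover.
move=> /(_ Y [set: Y] (fun y => (xsection E y)^°%classic)) [| |D _ Dcov].
- by move=> y _; exact: open_interior.
- by move=> y _; exists y => //; exact: nbhs_entourage.
have covD x : exists i : D, E (val i, x).
  have [y /= yD /interior_subset/xsectionP Eyx] := Dcov x I.
  by exists [` yD ]%fset.
by have [c cE] := choice covD; exists D, val, c.
Qed.

Lemma compact_orbit_return (X : uniformType) (E : set (X * X)) (s : X -> X)
    (x : X) :
  compact [set: X] -> entourage E ->
  exists i k, E (iter i s x, iter (i + k.+1) s x).
Proof.
move=> cX entE; have [B symB B4] := sym_entourage_split4 _ _ entE.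
have Brefl y : B (y, y) by apply: entourage_refl; case: symB.
have [I [z [c cB]]] := compact_finite_net _ B (ex_intro _ x I) cX symB.1.
(* Two points of the orbit share a net point, so they are close to each other. *)
have [i [k eq_ik]] := nat_finType_collision _ (fun n => c (iter n s x)).
exists i, k; apply: (B4 _ _ _ _ _ (sym_entourageC symB (cB _))) => //.
by rewrite eq_ik.
Qed.

(* In the conclusion E does not depend on D or s: this is what makes the
   distality uniform over a semigroup. *)
Lemma equicontinuous_surjection_distal (X : uniformType) (A : set (X * X)) :
  [set: X] !=set0 -> compact [set: X] -> entourage A ->
  exists2 E, sym_entourage E &
    forall (D : set (X * X)) (s : X -> X), sym_entourage D ->
      range s = [set: X] ->
      (forall n x y, D (x, y) -> E (iter n s x, iter n s y)) ->
      forall x y, D (s x, s y) -> A (x, y).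
Proof.
move=> X0 cX entA; have [B symB B4] := sym_entourage_split4 _ _ entA.
have [E symE E4] := sym_entourage_split4 _ _ symB.1.
have Erefl y : E (y, y) by apply: entourage_refl; case: symE.
have Brefl y : B (y, y) by apply: entourage_refl; case: symB.
exists E => // D s symD surj equi.
have [I [z [c cD]]] := compact_finite_net _ _ X0 cX symD.1.
have [J [w [d dE]]] := compact_finite_net _ _ X0 cX symE.1.
(* The colouring of [n] records the [E]-cells of the images of all points [z j] at once, so one pair
   [i], [k] serves the whole net. *)
have [i [k eq_ik]] := nat_finType_collision _
  (fun n => [ffun j : I => d (iter n s (z j))]).
have close_powers x : B (iter i s x, iter (i + k.+1) s x).
  (* The chain runs through the image of [z (c x)] under the lower power, the common net point of
     [w], and the image of [z (c x)] under the higher power. *)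
  apply: E4; last exact: equi (cD x).
  - exact: equi (sym_entourageC symD (cD x)).
  - exact: sym_entourageC symE (dE _).
  - by move/ffunP: eq_ik => /(_ (c x)); rewrite !ffunE => ->.
have surj_iter n x : exists y, iter n s y = x.
  elim: n x => [|n IHn] x; first by exists x.
  have [y _ <-] : range s x by rewrite surj.
  by have [u <-] := IHn y; exists u.
have close_id x : B (x, iter k.+1 s x).
  by have [y <-] := surj_iter i x; rewrite -iterD addnC; exact: close_powers.
move=> x y Dxy; have close_iter : B (iter k.+1 s x, iter k.+1 s y).
  by rewrite !iterSr; exact: E4 (equi k _ _ Dxy) (Erefl _) (Erefl _) (Erefl _).
exact: B4 (close_id x) close_iter (sym_entourageC symB (close_id y)) (Brefl _).
Qed.

Section Semiflow.
Variables (T : monoidType) (X : uniformType) (f : semiflow T X).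

(** This lets bounds uniform over [T] control all iterates of one acting map. *)
Lemma semiflow_iter (t : T) n : exists u : T, iter n (f t) = f u.
Proof.
elim: n => [|n [u IHn]]; first by exists 1%g; apply/funext => x; rewrite semiflow1.
by exists (t * u)%g; apply/funext => x; rewrite iterS IHn semiflowM.
Qed.

Lemma continuous_semiflow_act (t : T) : continuous (f t).
Proof.
move=> x; apply: (continuous_comp (f := fun y => (t, y) : discrete_topology T * X)
  (g := fun p => f p.1 p.2)); last exact: semiflow_continuous.
exact: (cvg_pair (cvg_cst (t : discrete_topology T)) cvg_id).
Qed.

Lemma uniformly_distalP (A : set (X * X)) : uniformly_distal f -> entourage A ->
  exists2 D, sym_entourage D & forall t x y, D (f t x, f t y) -> A (x, y).
Proof.
move=> ud entA; have [B symB BA] := sym_entourage_core _ _ entA.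
have [D symD DB] := ud B symB; exists D => // t x y Dxy; apply: BA.
by apply: contrapT => /DB /(_ t).
Qed.

Lemma uniformly_distal_inj (t : T) : hausdorff_space X -> uniformly_distal f ->
  injective (f t).
Proof.
move=> hX ud x y fxy; apply: close_eq => //; rewrite entourage_close => A entA.
have [D symD DA] := uniformly_distalP _ ud entA.
by apply: (DA t); rewrite fxy; apply: entourage_refl; case: symD.
Qed.

Lemma uniformly_distal_surjective : compact [set: X] -> hausdorff_space X ->
  uniformly_distal f -> surjective_semiflow f.
Proof.
move=> cX hX ud t; apply/seteqP; split=> // x _.
have clf : closed (range (f t)).
  apply: compact_closed => //; apply: continuous_compact => //.
  exact/continuous_subspaceT/continuous_semiflow_act.
(* The range is closed, so it suffices that it meets every neighbourhood of [x]. *)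
apply: clf => U /nbhsP [A entA AU].
have [D symD DA] := uniformly_distalP _ ud entA.
have [i [k]] := compact_orbit_return _ D (f t) x cX symD.1.
(* Distality cancels the common factor [f u], the [i]-th iterate of [f t]. *)
rewrite iterD; have [u ->] := semiflow_iter t i; move=> /DA Axk.
exists (iter k.+1 (f t) x); split; first by exists (iter k (f t) x).
exact/AU/xsectionP.
Qed.

Lemma equicontinuous_surjective_distal : [set: X] !=set0 -> compact [set: X] ->
  equicontinuous_semiflow f -> surjective_semiflow f -> uniformly_distal f.
Proof.
move=> X0 cX equi surj A [entA _].
have [E symE EA] := equicontinuous_surjection_distal _ _ X0 cX entA.
have [D symD DE] := equi E symE; exists D => // x y nAxy t Dxy.
apply: nAxy; apply: (EA D (f t)) => // n x' y' Dxy'.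
by have [u ->] := semiflow_iter t n; exact: DE.
Qed.

Lemma uniformly_distal_equicontinuous : [set: X] !=set0 -> compact [set: X] ->
  hausdorff_space X -> uniformly_distal f -> equicontinuous_semiflow f.
Proof.
move=> X0 cX hX ud A [entA _].
have [E symE EA] := equicontinuous_surjection_distal _ _ X0 cX entA.
have [D symD DE] := uniformly_distalP _ ud symE.1.
exists D => // x y Dxy t.
have surj x' : exists y', f t y' = x'.
  have [y' _ <-] : range (f t) x' by rewrite uniformly_distal_surjective.
  by exists y'.
have [g gK] := choice surj.
have fK x' : g (f t x') = x' by apply: (uniformly_distal_inj t).
apply: (EA D g) => //; last by rewrite !fK.
- by apply/seteqP; split=> // x' _; exists (f t x').
(* The inverse [g] need not act by a member of [T], but [f u] undoes its [n]-th iterate, so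
   distality at [u] gives the bound. *)
- move=> n x' y' Dxy'; have [u fu] := semiflow_iter t n.
  have iterK z : f u (iter n g z) = z.
    by rewrite -fu; elim: n z {fu} => // n IHn z; rewrite iterSr iterS gK.
  by apply: (DE u); rewrite !iterK.
Qed.

End Semiflow.

Theorem theorem1p14 (X : uniformType) (X_nonempty : [set: X] !=set0)
    (X_compact : compact [set: X]) (X_hausdorff : hausdorff_space X)
    (T : monoidType) (T_infinite : infinite_set [set: T])
    (f : semiflow T X) :
  uniformly_distal f <-> equicontinuous_semiflow f /\ surjective_semiflow f.
Proof.
split=> [ud|[equi surj]]; last exact: equicontinuous_surjective_distal.
split; first exact: uniformly_distal_equicontinuous.
exact: uniformly_distal_surjective.
Qed.
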